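(* Let $n\ge 2$. Suppose $V$ is an $S_n$-module which can be written as an integer combination $V=\bigoplus_{k=1}^{m}c_k S_{(n-1,1)}^{\otimes k}$ (as a virtual module, $c_k\in\mathbb{Z}$) of positive tensor powers of $S_{(n-1,1)}$. Then: (1) The character value of $V$ on fixed-point-free permutations is $\sum_{k=1}^{m}(-1)^k c_k$. (2) If $\sum_{k=1}^m(-1)^{k-1}c_k=0$, then the Frobenius characteristic of $V$ is supported on the set $\{h_\lambda:\lambda=(n-r,1^r),\ r\ge 2\}$. (3) If $\sum_{k=1}^m(-1)^{k-1}c_k=0$ and $c_k\ge 0$ for all $k\ge 2$, then the Frobenius characteristic of $V$ is $h$-positive and hence $V$ is a permutation module.
   Context: $S_{(n-1,1)}$ is the irreducible complex $S_n$-module indexed by the partition $(n-1,1)$. The Frobenius characteristic sends (virtual) $S_n$-modules to symmetric functions of degree $n$. $h_m$ is the complete homogeneous symmetric function, $h_0=1$, and $h_{(n-r,1^r)}=h_1^r h_{n-r}$, where $r\le n$. ''Supported on'' a set means being a linear combination of elements of that set; ''$h$-positive'' means a nonnegative combination of the $h_\lambda$. A permutation module is one having a basis permuted by $S_n$. *)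

(* Defs.v *)
From HB Require Import structures.
From mathcomp Require Import all_boot all_order all_algebra all_fingroup.
From mathcomp Require Import all_solvable all_field all_character.
From mathcomp Require Import mpoly.

Set Implicit Arguments.
Unset Strict Implicit.
Unset Printing Implicit Defensive.

Import Order.TTheory GRing.Theory Num.Theory.

Local Open Scope ring_scope.

Section SnModules.

(* C stands for the field of complex numbers: R[i], for any real closed field
   R, and algC are instances. *)
Variables (C : numClosedFieldType) (n : nat).

(* A module is a matrix representation, acting on row vectors from the right. *)
Definition Sn_module := representation C [set: 'S_n]%G.

(* Specht modules.  The canonical tableau of shape lam contains the entries
   0, ..., n-1 in reading order, so that i : 'I_n sits in row
   reshape_index lam i and column reshape_offset lam i. *)
Definition row_stab (lam : seq nat) : {set 'S_n} :=
  [set p : 'S_n | [forall i, reshape_index lam (p i) == reshape_index lam i]].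

Definition col_stab (lam : seq nat) : {set 'S_n} :=
  [set q : 'S_n | [forall i, reshape_offset lam (q i) == reshape_offset lam i]].

Definition young_symmetrizer (lam : seq nat) : 'M[C]_#|[set: 'S_n]| :=
  \sum_(p in row_stab lam) \sum_(q in col_stab lam)
     (-1) ^+ q *: regular_repr C [set: 'S_n] (p * q)%g.

(* The irreducible module indexed by lam (a partition of n): the submodule of
   the regular module generated by the Young symmetrizer of shape lam. *)
Definition specht (lam : seq nat) : Sn_module :=
  Representation
    (submod_repr (cyclic_mx_module (regular_repr C [set: 'S_n])
                    (gring_row (young_symmetrizer lam)))).

Lemma triv_mx_repr : mx_repr [set: 'S_n] (fun _ => 1%:M : 'M[C]_1).
Proof. by split=> // g h _ _; rewrite mulmx1. Qed.

Definition triv_module : Sn_module :=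
  Representation (MxRepresentation triv_mx_repr).

Definition tensor (U W : Sn_module) : Sn_module :=
  Representation (prod_repr U W).

Definition tensor_power (U : Sn_module) (k : nat) : Sn_module :=
  iterop k tensor U triv_module.

Definition pos_part (z : int) : nat := if z is Posz a then a else 0%N.
Definition neg_part (z : int) : nat := if z is Negz a then a.+1 else 0%N.

(* V = sum_(1 <= k <= m) c_k W_k as virtual modules: moving the terms with
   c_k < 0 to the side of V gives isomorphic modules. *)
Definition virtual_sum (V : Sn_module) (m : nat) (c : nat -> int)
    (W : nat -> Sn_module) : Prop :=
  mx_rsim
    (dadd_grepr V (\big[dadd_grepr/grepr0]_(1 <= k < m.+1)
                      muln_grepr (W k) (neg_part (c k))))
    (\big[dadd_grepr/grepr0]_(1 <= k < m.+1)
        muln_grepr (W k) (pos_part (c k))).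

Definition is_permutation_module (V : Sn_module) : Prop :=
  exists2 B : 'M[C]_(rdegree V), B \in unitmx
    & forall (g : 'S_n) i, exists j, row i B *m V g = row j B.

End SnModules.

Section SymmetricFunctions.

Variable C : numClosedFieldType.

(* A symmetric function is given, as an element of the inverse limit of the
   rings of symmetric polynomials, by its restrictions to x_1, ..., x_N for
   all N. *)
Definition symfun := forall N : nat, {mpoly C[N]}.

Definition power_sum (k : nat) : symfun := fun N => \sum_(i < N) 'X_i ^+ k.

Definition complete_sym (d : nat) : symfun :=
  fun N => \sum_(mon : 'X_{1..N < d.+1} | mdeg mon == d) 'X_[mon].

Definition h_ (lam : seq nat) : symfun :=
  fun N => \prod_(d <- lam) complete_sym d N.

(* (1/n!) sum_w chi_V(w) p_{cycle type of w} *)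
Definition frobenius_char (n : nat) (V : Sn_module C n) : symfun :=
  fun N => (n`!%:R)^-1 *:
    \sum_(w : 'S_n) \tr (V w) *: \prod_(o in porbits w) power_sum #|o| N.

Definition is_partition (lam : seq nat) : bool :=
  sorted geq lam && (0%N \notin lam).

Definition h_combination (s : seq (C * seq nat)) : symfun :=
  fun N => \sum_(t <- s) t.1 *: h_ t.2 N.

Definition h_supported_on (A : seq nat -> Prop) (f : symfun) : Prop :=
  exists2 s : seq (C * seq nat), (forall t, t \in s -> A t.2)
    & forall N, f N = h_combination s N.

Definition h_positive (f : symfun) : Prop :=
  exists2 s : seq (C * seq nat),
    (forall t, t \in s -> 0 <= t.1 /\ is_partition t.2)
    & forall N, f N = h_combination s N.

End SymmetricFunctions.

(* (n-r, 1^r); for r = n the leading part is 0, which is harmless as h_0 = 1. *)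
Definition part_ones (n r : nat) : seq nat := (n - r)%N :: nseq r 1%N.

(* Main.v *)
Require Import Defs.
From mathcomp Require Import all_boot all_order all_algebra all_fingroup.
From mathcomp Require Import all_solvable all_field all_character.
From mathcomp Require Import mpoly ring.

Set Implicit Arguments.
Unset Strict Implicit.
Unset Printing Implicit Defensive.

Import Order.TTheory GRing.Theory Num.Theory.

Local Open Scope ring_scope.

(** The character of S_(n-1,1) is fix - 1, so the character of V is Q(fix), where
    Q(x) = sum_k c_k (x - 1)^k.  If Q(0) = 0 then, as Q(1) = 0 always holds, Q is
    a combination of the falling factorials x(x-1)...(x-r+1) with r >= 2.  At
    x = fix this falling factorial is the character of the permutation module on
    the injections from an r-set to an n-set, whose Frobenius characteristic is
    h_(n-r,1^r).  Modulo the relation Q(0) = 0 one may replace (x - 1)^k by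
    (x - 1)^k + (-1)^k (x - 1), which vanishes for k = 1 and has nonnegative
    coefficients on falling factorials; this gives the positivity.  Finally, in
    characteristic 0 equality of characters implies isomorphism. *)

Definition nfix n (g : 'S_n) : nat := #|[set i | g i == i]|.

Lemma natr_nfix (R : nzRingType) n (g : 'S_n) :
  (nfix g)%:R = \sum_i (g i == i)%:R :> R.
Proof.
rewrite /nfix -sum1_card natr_sum big_mkcond; apply: eq_bigr => i _.
by rewrite inE; case: eqP.
Qed.

(** * The character of the Specht module of shape (n-1,1) *)

Section SubmoduleTrace.

Variables (F : fieldType) (gT : finGroupType) (G : {group gT}) (n : nat).
Variables (rG : mx_representation F G n) (U : 'M[F]_n) (Umod : mxmodule rG U).

(** [submod_repr] works in the basis [row_base U]. Any other basis [B] differs from it by an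
    invertible change of coordinates, so the trace may be read off in whichever basis is
    convenient. *)
Lemma mxtrace_submod_basis d (B : 'M_(d, n)) (A : 'M_d) g :
    row_free B -> (B :=: U)%MS -> g \in G -> B *m rG g = A *m B ->
  \tr (submod_repr Umod g) = \tr A.
Proof.
move=> freeB eqBU Gg BA.
have Bb : (B <= row_base U)%MS by rewrite eq_row_base eqBU.
have bB : (row_base U <= B)%MS by rewrite eq_row_base eqBU.
set P := row_base U *m pinvmx B.
have PB : P *m B = row_base U by rewrite mulmxKpV.
have QB : B *m pinvmx (row_base U) *m row_base U = B by rewrite mulmxKpV.
set Q := B *m pinvmx (row_base U) in QB; clearbody P Q.
have QP1 : Q *m P = 1%:M.
  by apply: (row_free_inj freeB); rewrite -mulmxA PB QB mul1mx.
have PAQ : submod_repr Umod g = P *m A *m Q.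
  apply: (row_free_inj (row_base_free U)).
  have := val_submodJ Umod 1%:M Gg; rewrite /val_submod /= !mul1mx => ->.
  by rewrite -mulmxA QB -mulmxA -BA [RHS]mulmxA PB.
by rewrite PAQ -mulmxA mxtrace_mulC -mulmxA QP1 mulmx1.
Qed.

End SubmoduleTrace.

Section SpechtTrace.

Variables (C : numClosedFieldType) (k : nat).
Local Notation n := k.+2.
Local Notation G := [set: 'S_n]%G.
Local Notation lam := [:: k.+1; 1%N].
Local Notation reg := (regular_repr C G).

Let delta (g : 'S_n) : 'rV[C]_#|G| := delta_mx 0 (gring_index G g).

Let deltaM g h : delta g *m reg h = delta (g * h)%g.
Proof. by rewrite /delta -rowE rowK gring_indexK ?inE. Qed.

Let gring_row_reg g : gring_row (reg g) = delta g.
Proof. by rewrite /gring_row rowK gring_indexK ?inE // mul1g. Qed.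

Let reshape_index_hook (i : 'I_n) : reshape_index lam i = (i == ord_max) :> nat.
Proof.
rewrite /reshape_index /= -val_eqE /=; have := ltn_ord i.
rewrite subSS subn_eq0 ltnS leq_eqVlt => /orP[/eqP->|lt_ik].
  by rewrite ltnn subSn // subnn eqxx.
by rewrite -ltnS lt_ik (ltn_eqF lt_ik).
Qed.

Let reshape_offset_hook (i : 'I_n) :
  reshape_offset lam i = if i == ord_max then 0%N else i.
Proof.
rewrite /reshape_offset reshape_index_hook.
case: eqP => [->|_] /=; last by rewrite subn0.
by rewrite addn0 subnn.
Qed.

Let row_stab_hook (p : 'S_n) : (p \in row_stab n lam) = (p ord_max == ord_max).
Proof.
rewrite inE; apply/forallP/eqP => [/(_ ord_max)|pmax i].
  by rewrite !reshape_index_hook eqxx; case: (p ord_max =P ord_max).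
by rewrite !reshape_index_hook -{1}pmax (inj_eq perm_inj).
Qed.

Let t : 'S_n := tperm ord0 ord_max.

(** Only column 0 has two entries, [ord0] above [ord_max]; every other column is a single cell, so
    an element of the stabilizer fixes all other points. *)
Let col_stab_hook : col_stab n lam = [set 1%g; t].
Proof.
apply/setP=> q; rewrite !inE; apply/forallP/orP=> [qP | [] /eqP-> i].
- have qfix i : i != ord0 -> i != ord_max -> q i = i.
    move=> i0 im; have /eqP := qP i; rewrite !reshape_offset_hook (negPf im).
    case: eqP => _ // /esym ei; first by rewrite -val_eqE /= ei in i0.
    exact/val_inj.
  have q_on : perm_on [set ord0; ord_max] q.
    apply/subsetP=> i; rewrite !inE; apply: contraR.
    by rewrite negb_or => /andP[i0 im]; rewrite qfix.
  have := perm_closed ord0 q_on; rewrite !inE eqxx => /orP[/eqP q0|/eqP q0].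
    left; apply/eqP/permP=> i; rewrite perm1.
    have := perm_closed ord_max q_on; rewrite !inE eqxx orbT -{1}q0.
    rewrite (inj_eq perm_inj) /= => /eqP qm.
    have [->//|i0] := eqVneq i ord0; have [->//|im] := eqVneq i ord_max.
    exact: qfix.
  right; apply/eqP/permP=> i.
  have := perm_closed ord_max q_on; rewrite !inE eqxx orbT -{3}q0.
  rewrite (inj_eq perm_inj) /= orbF => /eqP qm.
  by rewrite /t; case: tpermP => [->|->|/eqP ? /eqP ?] //; rewrite qfix.
- by rewrite perm1.
- by rewrite !reshape_offset_hook /t; case: tpermP => // ->; rewrite ?eqxx.
Qed.

(* The sum of the permutations mapping the last point to i: these rows span a
   copy of the natural permutation module inside the regular module. *)
Let cosetrow (i : 'I_n) : 'rV[C]_#|G| :=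
  \sum_(g : 'S_n | g ord_max == i) delta g.

Let cosetrowM i h : cosetrow i *m reg h = cosetrow (h i).
Proof.
rewrite mulmx_suml [RHS](reindex_inj (mulIg h)) /=.
under eq_bigr do rewrite deltaM.
by apply: eq_bigl => g; rewrite permM (inj_eq perm_inj).
Qed.

Let cosetrowE i (g : 'S_n) :
  cosetrow i 0 (gring_index G g) = (g ord_max == i)%:R.
Proof.
have dE h : delta h 0 (gring_index G g) = (g == h)%:R.
  rewrite /delta mxE eqxx /=; congr (nat_of_bool _)%:R.
  by apply/eqP/eqP => [/(congr1 enum_val)|-> //]; rewrite !gring_indexK ?inE.
rewrite summxE; under eq_bigr do rewrite dE.
have [gi|gi] := eqVneq.
  rewrite (bigD1 g) ?gi ?eqxx //= big1 ?addr0 // => h /andP[_].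
  by rewrite eq_sym => /negPf->.
by rewrite big1 // => h; case: (eqVneq g h) gi => // -> /negPf->.
Qed.

(** The row stabilizer is the stabilizer of [ord_max], whose sum is [cosetrow ord_max]. Right
    multiplication by [t] turns it into [cosetrow ord0], and [t] is odd. *)
Let gring_row_young :
  gring_row (young_symmetrizer C n lam) = cosetrow ord_max - cosetrow ord0.
Proof.
have t1 : 1%g != t.
  by apply/eqP=> /permP/(_ ord0); rewrite perm1 tpermL.
have c0E : cosetrow ord0 = \sum_(g : 'S_n | g ord_max == ord_max) delta (g * t)%g.
  rewrite /cosetrow (reindex_inj (mulIg t)) /=; apply: eq_bigl => g.
  by rewrite permM -{1}(tpermR ord0 ord_max) (inj_eq perm_inj).
rewrite c0E /cosetrow -sumrB /young_symmetrizer linear_sum /=.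
rewrite (eq_bigl _ _ row_stab_hook); apply: eq_bigr => g _.
rewrite linear_sum /= col_stab_hook big_setU1 ?inE //= big_set1.
rewrite !linearZ /= !gring_row_reg odd_perm1 odd_tperm -val_eqE /=.
by rewrite expr0 expr1 scale1r scaleN1r mulg1.
Qed.

(** A basis of the sum-zero part of the copy of the natural module spanned by the [cosetrow]s. *)
Let basis : 'M[C]_(k.+1, #|G|) :=
  \matrix_i (cosetrow (lift ord0 i) - cosetrow ord0).

Let cosetrow_basis l :
  cosetrow l - cosetrow ord0 = (\row_j (l == lift ord0 j)%:R) *m basis.
Proof.
rewrite mulmx_sum_row; under eq_bigr do rewrite mxE rowK.
have [j ->|->] := unliftP ord0 l.
  rewrite (bigD1 j) //= eqxx scale1r big1 ?addr0 // => i.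
  by rewrite (inj_eq lift_inj) eq_sym => /negPf->; rewrite scale0r.
by rewrite subrr big1 // => i _; rewrite (negPf (neq_lift _ _)) scale0r.
Qed.

Let cosetrow_sub_basis i j : (cosetrow i - cosetrow j <= basis)%MS.
Proof.
rewrite -[_ - _](subrKA (cosetrow ord0)) addmx_sub //.
  by rewrite cosetrow_basis submxMl.
by rewrite -opprB eqmx_opp cosetrow_basis submxMl.
Qed.

Let basis_free : row_free basis.
Proof.
apply/inj_row_free => v v0; apply/rowP=> j.
(* This transposition sends [ord_max] to [lift ord0 j], so row [j] of [basis] is the only one with a
   nonzero entry there. *)
have /matrixP/(_ 0 (gring_index G (tperm ord_max (lift ord0 j)))) := v0.
rewrite mulmx_sum_row summxE (bigD1 j) //= big1 => [|i ij].
  rewrite rowK !mxE !cosetrowE tpermL eqxx eq_sym (negPf (neq_lift _ _)).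
  by rewrite subr0 mulr1 addr0.
rewrite rowK !mxE !cosetrowE tpermL (inj_eq lift_inj) eq_sym (negPf ij).
by rewrite eq_sym (negPf (neq_lift _ _)) subr0 mulr0.
Qed.

Let basis_span :
  (basis :=: cyclic_mx reg (gring_row (young_symmetrizer C n lam)))%MS.
Proof.
apply/eqmxP/andP; split.
  apply/row_subP=> i; rewrite rowK; apply/cyclic_mxP.
  (* It fixes [ord0] and moves [ord_max] to [lift ord0 i], hence sends the generator to the [i]-th
     basis row. *)
  exists (reg (tperm ord_max (lift ord0 i))).
    by rewrite envelop_mx_id ?inE.
  rewrite gring_row_young mulmxBl !cosetrowM tpermL tpermD //.
rewrite cyclic_mx_sub ?gring_row_young ?cosetrow_sub_basis //.
apply/mxmoduleP=> g _; apply/row_subP=> i.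
by rewrite row_mul rowK mulmxBl !cosetrowM cosetrow_sub_basis.
Qed.

Lemma mxtrace_specht_hook (g : 'S_n) :
  \tr (specht C n lam g) = (nfix g)%:R - 1.
Proof.
pose A : 'M[C]_k.+1 := \matrix_(i, j)
  ((g (lift ord0 i) == lift ord0 j)%:R - (g ord0 == lift ord0 j)%:R).
rewrite (mxtrace_submod_basis _ (A := A) basis_free basis_span) ?inE //.
  rewrite natr_nfix /mxtrace [in RHS]big_ord_recl /=.
  under eq_bigr do rewrite mxE.
  rewrite sumrB.
  (* [g ord0] is exactly one of [ord0] and the points [lift ord0 j]; the term for [ord0] completes
     the count of fixed points. *)
  suff -> : \sum_j (g ord0 == lift ord0 j)%:R = 1 - (g ord0 == ord0)%:R :> C.
    by rewrite opprB addrCA addrA.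
  have [j g0|g0] := unliftP ord0 (g ord0); rewrite g0.
    rewrite (bigD1 j) //= eqxx big1 => [|i]; last first.
      by rewrite (inj_eq lift_inj) eq_sym => /negPf->.
    by rewrite addr0 subr0.
  by rewrite eqxx subrr big1.
apply/row_matrixP=> i; rewrite !row_mul rowK mulmxBl !cosetrowM.
rewrite -[LHS](subrKA (cosetrow ord0)) -[X in _ + X]opprB !cosetrow_basis.
rewrite -mulmxBl; congr (_ *m _); apply/rowP=> j.
by rewrite !mxE.
Qed.

End SpechtTrace.

(** * Characters determine modules in characteristic 0 *)

Section Traces.

Variables (F : fieldType) (gT : finGroupType) (G : {group gT}).

Lemma mxtrace_dadd (rG1 rG2 : representation F G) g :
  \tr (dadd_grepr rG1 rG2 g) = \tr (rG1 g) + \tr (rG2 g).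
Proof. exact: mxtrace_block. Qed.

Lemma mxtrace_dsum I r (P : pred I) (rG : I -> representation F G) g :
  \tr ((\big[dadd_grepr/grepr0]_(i <- r | P i) rG i) g)
    = \sum_(i <- r | P i) \tr (rG i g).
Proof.
apply: (big_morph (fun rG0 : representation F G => \tr (rG0 g))).
  by move=> rG1 rG2; apply: mxtrace_dadd.
exact: mxtrace1.
Qed.

Lemma mxtrace_muln (rG : representation F G) k g :
  \tr (muln_grepr rG k g) = \tr (rG g) *+ k.
Proof. by rewrite mxtrace_dsum sumr_const card_ord. Qed.

(** By linearity, the character on [G] determines the traces of all group ring elements, in
    particular of the central idempotents used below. *)
Lemma mxtrace_gring_op n (rG : mx_representation F G n) A :
  \tr (gring_op rG A) =
    \sum_j gring_row A 0 j * \tr (rG (enum_val j)).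
Proof.
rewrite gring_opE /gring_mx /= mulmx_sum_row !linear_sum /=.
by apply: eq_bigr => j _; rewrite !linearZ /= rowK mxvecK.
Qed.

End Traces.

Section EqualTraces.

Variables (F : decFieldType) (gT : finGroupType) (G : {group gT}).
Hypothesis charF0 : [pchar F] =i pred0.

Let F'G : ([pchar F]^'.-group G)%g.
Proof. by apply/pgroupP=> p _ _; rewrite inE /= charF0. Qed.

Let sG : irrType F G := DecSocleType (regular_repr F G).
Let irrG (i : sG) : representation F G := Representation (socle_repr i).

Let irr_sort : rel sG := fun i j => (enum_rank i <= enum_rank j)%N.

(* Sorting the constituents makes the decomposition depend only on their
   multiplicities. *)
Let irr_decomposition (rG : representation F G) :
  exists2 s : seq sG, sorted irr_sort s
    & mx_rsim rG (\big[dadd_grepr/grepr0]_(i <- s) irrG i).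
Proof.
have [I U /= simU defV dxV] : mxsemisimple rG 1%:M.
  exact: dec_mx_reducible_semisimple (mxmodule1 _) (mx_Maschke_pchar rG F'G).
pose c i := irr_comp sG (submod_repr (mxsimple_module (simU i))).
have cP i : mx_rsim (submod_repr (mxsimple_module (simU i))) (irrG (c i)).
  by apply: rsim_irr_comp_pchar => //; apply/submod_mx_irr.
pose leI : rel I := relpre c irr_sort.
pose t : #|I|.-tuple I := sort_tuple leI (enum_tuple I).
exists (map c t).
  rewrite sorted_map; apply: sort_sorted => i j; exact: leq_total.
have t_uniq : uniq t by rewrite sort_uniq enum_uniq.
have t_bij : bijective (tnth t).
  apply: inj_card_bij; last by rewrite card_ord.
  exact/tuple_uniqP.
have reindexI := reindex _ (onW_bij _ t_bij).
rewrite mxdirectE /= !reindexI -mxdirectE /= in defV dxV.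
apply: mx_rsim_trans (mx_rsim_sym (rsim_submod1 (mxmodule1 _) _)) _ => //.
rewrite big_map big_tuple.
exact: mx_rsim_dsum (fun i => mxsimple_module (simU (tnth t i))) _ defV dxV _.
Qed.

(** The idempotent [Wedderburn_id j] acts as the identity on [irrG j] and as zero on the other
    irreducibles, so its trace detects the multiplicity of [j]. *)
Let mxtrace_Wedderburn_id (s : seq sG) j :
  \tr (gring_op (\big[dadd_grepr/grepr0]_(i <- s) irrG i) (Wedderburn_id j))
    = (count_mem j s * rdegree (irrG j))%:R.
Proof.
have trE i : \tr (gring_op (irrG i) (Wedderburn_id j)) =
    ((i == j) * rdegree (irrG j))%:R.
  have [->|ij] := eqVneq i j; last first.
    rewrite (irr_repr'_op0_pchar _ _ (Wedderburn_id_mem j)) // ?mxtrace0 //.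
    by rewrite eq_sym.
  by rewrite op_Wedderburn_id_pchar // mxtrace1 mul1n.
rewrite mxtrace_gring_op.
under [LHS]eq_bigr do rewrite mxtrace_dsum mulr_sumr.
rewrite exchange_big /=; under eq_bigr do rewrite -mxtrace_gring_op trE.
rewrite -natr_sum -big_distrl /=; congr (_ * _)%:R.
rewrite -sum1_count [RHS]big_mkcond; apply: eq_bigr => i _ /=.
by case: (i == j).
Qed.

(** Equal characters give equal traces of each [Wedderburn_id j]. In characteristic 0 these traces
    determine the multiplicities, and sorted lists with the same multiplicities coincide. *)
Theorem mxtrace_eq_rsim (rG1 rG2 : representation F G) :
  {in G, forall g, \tr (rG1 g) = \tr (rG2 g)} -> mx_rsim rG1 rG2.
Proof.
move=> eq_tr; have [s1 s1_sorted rsim1] := irr_decomposition rG1.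
have [s2 s2_sorted rsim2] := irr_decomposition rG2.
suff eq12 : s1 = s2.
  by rewrite -{}eq12 in rsim2; apply: mx_rsim_trans rsim1 (mx_rsim_sym rsim2).
apply: (sorted_eq _ _ s1_sorted s2_sorted).
- by move=> i j k; apply: leq_trans.
- by move=> i j; rewrite -eqn_leq => /eqP/val_inj/enum_rank_inj.
apply/allP=> j _ /=.
have nj_gt0 : (0 < rdegree (irrG j))%N by rewrite irr_degree_gt0.
have natr_inj (a b : nat) : a%:R = b%:R :> F -> a = b.
  wlog le_ab : a b / (a <= b)%N => [IH | /esym/eqP].
    by case: (leqP a b) => [|/ltnW] le_ab ab; [|apply/esym]; apply: IH.
  rewrite -subr_eq0 -natrB // (GRing.pcharf0P _).1 // subn_eq0 => le_ba.
  by apply/eqP; rewrite eqn_leq le_ab.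
rewrite -(eqn_pmul2r nj_gt0); apply/eqP/natr_inj.
rewrite -!mxtrace_Wedderburn_id !mxtrace_gring_op; apply: eq_bigr => g _.
rewrite -(mxtrace_rsim rsim1) -?(mxtrace_rsim rsim2) ?enum_valP //.
by rewrite eq_tr ?enum_valP.
Qed.

End EqualTraces.

(** * Permutation modules *)

Section InjectionModule.

Variables (F : fieldType) (n r : nat).
Implicit Types (f : {ffun 'I_r -> 'I_n}) (g h : 'S_n).

Definition injections : {set {ffun 'I_r -> 'I_n}} :=
  [set f : {ffun _ -> _} | injectiveb f].

Definition inj_act f g : {ffun 'I_r -> 'I_n} := [ffun i => g (f i)].

Lemma inj_act_in f g : f \in injections -> inj_act f g \in injections.
Proof.
rewrite !inE => /injectiveP f_inj; apply/injectiveP => i j.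
by rewrite !ffunE => /perm_inj/f_inj.
Qed.

Lemma inj_actM f g h : inj_act (inj_act f g) h = inj_act f (g * h)%g.
Proof. by apply/ffunP=> i; rewrite !ffunE permM. Qed.

Definition inj_mx g : 'M[F]_#|injections| :=
  \matrix_(i, j) (inj_act (enum_val i) g == enum_val j)%:R.

Lemma row_inj_mx g i j :
  inj_act (enum_val i) g = enum_val j -> row i (inj_mx g) = delta_mx 0 j.
Proof.
move=> gi; apply/rowP=> l.
by rewrite !mxE eqxx gi (inj_eq enum_val_inj) eq_sym.
Qed.

Lemma inj_act_index g (i : 'I_#|injections|) :
  {j : 'I_#|injections| | inj_act (enum_val i) g = enum_val j}.
Proof.
have gi : inj_act (enum_val i) g \in injections.
  by rewrite inj_act_in ?enum_valP.
by exists (enum_rank_in gi (inj_act (enum_val i) g)); rewrite enum_rankK_in.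
Qed.

Lemma inj_mx_repr : mx_repr [set: 'S_n] inj_mx.
Proof.
split=> [|g h _ _]; apply/row_matrixP=> i.
  rewrite row1; apply: row_inj_mx.
  by apply/ffunP=> x; rewrite ffunE perm1.
have [j gi] := inj_act_index g i; have [l hj] := inj_act_index h j.
rewrite row_mul (row_inj_mx gi) -rowE (row_inj_mx hj); apply: row_inj_mx.
by rewrite -inj_actM gi.
Qed.

Definition inj_module : representation F [set: 'S_n]%G :=
  Representation (MxRepresentation inj_mx_repr).

(** The trace counts the injections fixed by [g], which are those with all values among the fixed
    points of [g]. *)
Lemma mxtrace_inj_module g : \tr (inj_module g) = (nfix g ^_ r)%:R.
Proof.
rewrite /mxtrace; under eq_bigr do rewrite mxE.
transitivity (\sum_(f in injections) (inj_act f g == f)%:R : F).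
  by rewrite [RHS]big_enum_val; apply: eq_bigr => i _; reflexivity.
rewrite -natr_sum -[in RHS](card_ord r) -card_inj_ffuns_on -sum1_card.
congr _%:R; rewrite [LHS]big_mkcond [RHS]big_mkcond; apply: eq_bigr => f _.
rewrite !inE; case: (injectiveb f); rewrite ?andbF ?andbT //=.
suff -> : (inj_act f g == f) = [forall i, f i \in [set j | g j == j]].
  by case: ifP.
apply/eqP/forallP=> [fixf i | fixf].
  by have /ffunP/(_ i) := fixf; rewrite inE ffunE => ->.
by apply/ffunP=> i; rewrite ffunE; have := fixf i; rewrite inE => /eqP.
Qed.

End InjectionModule.

Section PermutesBasis.

Variables (C : numClosedFieldType) (n : nat).

(** The form of [is_permutation_module] with the standard basis. It passes to direct sums directly;
    the change of basis is made once, in [permutation_module_rsim]. *)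
Definition permutes_basis (V : Sn_module C n) : Prop :=
  forall g i, exists j, row i (V g) = delta_mx 0 j.

Lemma permutes_basis_dadd (U W : Sn_module C n) :
  permutes_basis U -> permutes_basis W -> permutes_basis (dadd_grepr U W).
Proof.
move=> permU permW g i /=; rewrite -[i]splitK.
case: (split i) => i' /=; rewrite ?rowKu ?rowKd row_row_mx row0.
  by have [j ->] := permU g i'; exists (lshift _ j); rewrite delta_mx_lshift.
by have [j ->] := permW g i'; exists (rshift _ j); rewrite delta_mx_rshift.
Qed.

Lemma permutes_basis_dsum I s (P : pred I) (W : I -> Sn_module C n) :
    (forall i, permutes_basis (W i)) ->
  permutes_basis (\big[dadd_grepr/grepr0]_(i <- s | P i) W i).
Proof.
move=> permW; apply: (big_ind permutes_basis) => //; first by move=> g [].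
exact: permutes_basis_dadd.
Qed.

Lemma permutes_basis_inj r : permutes_basis (inj_module C n r).
Proof.
by move=> g i; have [j gi] := inj_act_index g i; exists j; apply: row_inj_mx.
Qed.

Lemma permutation_module_rsim (V P : Sn_module C n) :
  mx_rsim V P -> permutes_basis P -> is_permutation_module V.
Proof.
case: P => d P [/= B eq_d]; case: _ / eq_d P B => P B.
rewrite row_free_unit => Bunit VB permP.
(* The rows of the inverse of the intertwiner are the vectors of [V] matching the standard basis of
   [P]. *)
exists (invmx B); first by rewrite unitmx_inv.
move=> g i; have [j Pij] := permP g i; exists j.
rewrite -row_mul; have -> : invmx B *m V g = P g *m invmx B.
  by rewrite -[LHS](mulmxK Bunit) -(mulmxA _ (V g)) VB ?inE // mulKmx.
by rewrite row_mul Pij -rowE.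
Qed.

End PermutesBasis.

(** * Cycle index sums *)

Section LiftPerm.

Variables (n : nat) (i : 'I_n.+1).

Lemma lift_perm_inj : injective (lift_perm i i).
Proof.
move=> s t /permP st; apply/permP=> x.
by have := st (lift i x); rewrite !lift_perm_lift => /lift_inj.
Qed.

Lemma lift_perm_fix (w : 'S_n.+1) : w i = i -> {s | w = lift_perm i i s}.
Proof.
move=> wi.
have down x : {y | w (lift i x) = lift i y}.
  have [y ->|wx] := unliftP i (w (lift i x)); first by exists y.
  by have := neq_lift i x; rewrite -(inj_eq (@perm_inj _ w)) wi wx eqxx.
have down_inj : injective (fun x => sval (down x)).
  move=> x y; case: (down x) (down y) => x' wx [y' wy] /= xy.
  by apply/(@lift_inj _ i)/(@perm_inj _ w); rewrite wx wy xy.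
exists (perm down_inj); apply/permP=> x.
have [y ->|->] := unliftP i x; last by rewrite lift_perm_id.
by rewrite lift_perm_lift permE; case: (down y).
Qed.

Lemma big_lift_perm (R : Type) (idx : R) (op : Monoid.com_law idx)
    (F : 'S_n.+1 -> R) :
  \big[op/idx]_(w : 'S_n.+1 | w i == i) F w
    = \big[op/idx]_s F (lift_perm i i s).
Proof.
rewrite -(big_imset _ (in2W lift_perm_inj)) /=; apply: eq_bigl => w.
apply/eqP/imsetP => [/lift_perm_fix[s ->]|[s _ ->]]; first by exists s.
by rewrite lift_perm_id.
Qed.

Lemma nfix_lift_perm (s : 'S_n) : nfix (lift_perm i i s) = (nfix s).+1.
Proof.
have nfixE m (g : 'S_m) : nfix g = (\sum_x (g x == x))%N.
  rewrite /nfix -sum1_card big_mkcond; apply: eq_bigr => x _.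
  by rewrite inE; case: eqP.
rewrite !nfixE (bigD1_ord i) //= lift_perm_id eqxx; congr _.+1.
by apply: eq_bigr => x _; rewrite lift_perm_lift (inj_eq lift_inj).
Qed.

Lemma porbit_lift_perm (s : 'S_n) x :
  porbit (lift_perm i i s) (lift i x) = lift i @: porbit s x.
Proof.
have expE k : (lift_perm i i s ^+ k)%g (lift i x) = lift i ((s ^+ k)%g x).
  elim: k => [|k IH]; first by rewrite !expg0 !perm1.
  by rewrite !expgSr !permM IH lift_perm_lift.
apply/setP=> y; apply/porbitP/imsetP => [[k ->]|[_ /porbitP[k ->] ->]].
  by exists ((s ^+ k)%g x); rewrite ?mem_porbit ?expE.
by exists k; rewrite expE.
Qed.

Lemma porbit_lift_perm_id (s : 'S_n) : porbit (lift_perm i i s) i = [set i].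
Proof.
have expE k : (lift_perm i i s ^+ k)%g i = i.
  elim: k => [|k IH]; first by rewrite expg0 perm1.
  by rewrite expgSr permM IH lift_perm_id.
apply/setP=> y; rewrite inE; apply/porbitP/eqP => [[k ->] //|->].
by exists 0%N; rewrite expE.
Qed.

Lemma porbits_lift_perm (s : 'S_n) :
  porbits (lift_perm i i s)
    = [set i] |: [set lift i @: (o : {set 'I_n}) | o in porbits s].
Proof.
apply/setP=> o; apply/imsetP/setU1P.
  move=> [x _ ->]; have [y ->|->] := unliftP i x.
    by right; rewrite porbit_lift_perm imset_f ?imset_f.
  by left; rewrite porbit_lift_perm_id.
move=> [->|/imsetP[_ /imsetP[x _ ->] ->]].
  by exists i; rewrite ?porbit_lift_perm_id.
by exists (lift i x); rewrite ?porbit_lift_perm.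
Qed.

End LiftPerm.

Section CycleIndex.

Variables (C : numClosedFieldType) (N : nat).

(** The power sum indexed by the cycle type of [w], in [N] variables. *)
Definition cycle_monomial n (w : 'S_n) : {mpoly C[N]} :=
  \prod_(o in porbits w) power_sum C #|o| N.

Lemma cycle_monomial_lift n (i : 'I_n.+1) (s : 'S_n) :
  cycle_monomial (lift_perm i i s) = power_sum C 1 N * cycle_monomial s.
Proof.
rewrite /cycle_monomial porbits_lift_perm big_setU1 /= ?cards1; last first.
  apply/negP=> /imsetP[_ /imsetP[x _ ->]] /setP/(_ (lift i x)).
  by rewrite inE imset_f ?porbit_id // eq_sym (negPf (neq_lift _ _)).
rewrite big_imset /=; last by apply: in2W; apply: imset_inj; apply: lift_inj.
by congr (_ * _); apply: eq_bigr => o _; rewrite card_imset //; apply: lift_inj.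
Qed.

(** Expanding the product of power sums chooses one variable per cycle, which amounts to a word
    constant on the cycles of [w]. The maps [up] and [down] translate between choices and words,
    using the cycle index [idx] and a representative [rep] of each cycle. *)
Lemma cycle_monomialE n (w : 'S_n) :
  cycle_monomial w =
    \sum_(f : {ffun 'I_n -> 'I_N} | [forall i, f (w i) == f i])
       \prod_i 'X_(f i).
Proof.
pose K := #|porbits w|.
have porbits_in i : porbit w i \in porbits w by apply: imset_f.
pose idx i : 'I_K := enum_rank_in (porbits_in i) (porbit w i).
have idxK i : enum_val (idx i) = porbit w i.
  by rewrite enum_rankK_in.
have idx_eq i k : (idx i == k) = (i \in enum_val k).
  have /imsetP[j _ jk] : enum_val k \in porbits w by apply: enum_valP.
  by rewrite -(inj_eq enum_val_inj) idxK jk eq_porbit_mem.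
have reprP (k : 'I_K) : exists i, idx i == k.
  have /imsetP[j _ jk] : enum_val k \in porbits w by apply: enum_valP.
  by exists j; rewrite idx_eq jk porbit_id.
pose rep k := xchoose (reprP k).
have repK k : idx (rep k) = k by apply/eqP/(xchooseP (reprP k)).
pose up (h : {ffun 'I_K -> 'I_N}) : {ffun 'I_n -> 'I_N} := [ffun i => h (idx i)].
pose down (f : {ffun 'I_n -> 'I_N}) : {ffun 'I_K -> 'I_N} :=
  [ffun k => f (rep k)].
rewrite (reindex_onto up down) => [|f /forallP f_inv]; last first.
  have f_exp k i : f ((w ^+ k)%g i) = f i.
    elim: k => [|k IH]; first by rewrite expg0 perm1.
    by rewrite expgSr permM (eqP (f_inv _)) IH.
  apply/ffunP=> i; rewrite !ffunE.
  have : rep (idx i) \in porbit w i by rewrite -idxK -idx_eq repK.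
  by case/porbitP=> k ->.
rewrite (eq_bigl xpredT) => [|h]; last first.
  apply/andP; split; last by apply/eqP/ffunP=> k; rewrite !ffunE repK.
  apply/forallP=> i; rewrite !ffunE; apply/eqP; congr (h _).
  apply: enum_val_inj; rewrite !idxK; apply/eqP.
  by rewrite eq_porbit_mem -{1}[w]expg1 mem_porbit.
rewrite /cycle_monomial big_enum_val /power_sum bigA_distr_bigA /=.
apply: eq_bigr => h _; rewrite (partition_big idx xpredT) //=.
apply: eq_bigr => k _; rewrite -prodr_const; apply: eq_big => i.
  by rewrite idx_eq.
by rewrite ffunE -idx_eq => /eqP->.
Qed.

Definition content n (f : {ffun 'I_n -> 'I_N}) : 'X_{1..N} :=
  (\sum_i U_(f i))%MM.

Lemma contentE n (f : {ffun 'I_n -> 'I_N}) j :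
  content f j = count_mem j [tuple f i | i < n].
Proof.
rewrite /content mnm_sumE -sum1_count big_map val_ord_tuple big_enum_cond /=.
by rewrite [RHS]big_mkcond; apply: eq_bigr => i _; rewrite mnm1E; case: eqP.
Qed.

Lemma mdeg_content n (f : {ffun 'I_n -> 'I_N}) : mdeg (content f) = n.
Proof.
rewrite mdeg_sum /=; under eq_bigr do rewrite mdeg1.
by rewrite sum1_card card_ord.
Qed.

Lemma content_perm n (f : {ffun 'I_n -> 'I_N}) (w : 'S_n) :
  content [ffun i => f (w i)] = content f.
Proof.
rewrite /content; under eq_bigr do rewrite ffunE.
by rewrite [RHS](reindex_inj (@perm_inj _ w)).
Qed.

(** Transitivity of ['S_n] on the words of a given content: equal letter counts make the tuples of
    values permutations of each other. *)
Lemma content_eq n (f g : {ffun 'I_n -> 'I_N}) :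
  content f = content g -> exists w : 'S_n, f = [ffun i => g (w i)].
Proof.
move=> fg; have /tuple_permP[w fw] :
    perm_eq [tuple f i | i < n] [tuple g i | i < n].
  by apply/allP=> j _; rewrite /= -!contentE fg.
exists w; apply/ffunP=> i; rewrite ffunE.
have /val_inj/(congr1 (fun t => tnth t i)) := fw.
by rewrite !tnth_mktuple.
Qed.

Lemma content_surj n (m : 'X_{1..N}) :
  mdeg m = n -> exists f : {ffun 'I_n -> 'I_N}, content f = m.
Proof.
have [s ms] : exists s : seq 'I_N, m = (\sum_(j <- s) U_(j))%MM.
  rewrite [m]multinomUE_id.
  pose P (k : 'X_{1..N}) := exists s, k = (\sum_(j <- s) U_(j))%MM.
  apply: (big_ind P) => [|_ _ [s ->] [t ->]|i _].
  - by exists [::]; rewrite big_nil.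
  - by exists (s ++ t); rewrite big_cat.
  elim: (m i) => [|k [s IH]]; first by exists [::]; rewrite big_nil mulm0n.
  by exists (i :: s); rewrite big_cons mulmS IH.
have deg_s : mdeg m = size s.
  rewrite ms mdeg_sum /=; under eq_bigr do rewrite mdeg1.
  by rewrite sum1_size.
move=> deg_m; have sz_s : size s = n by rewrite -deg_s.
exists [ffun i => tnth (tcast sz_s (in_tuple s)) i].
rewrite ms -[s in RHS]/(tval (in_tuple s)) -(val_tcast sz_s) big_tuple.
by apply: eq_bigr => i _; rewrite ffunE.
Qed.

(* Orbit counting: the words of content m form a single orbit of S_n. *)
Lemma sum_card_content_stab n (m : 'X_{1..N}) :
  (\sum_(f : {ffun 'I_n -> 'I_N} | content f == m)
     \sum_(w : 'S_n) [forall i, f (w i) == f i])%N = (n`! * (mdeg m == n))%N.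
Proof.
have [/content_surj[f0 f0m]|deg_m] := eqVneq (mdeg m) n; last first.
  rewrite muln0 big1 // => f /eqP fm.
  by rewrite -fm mdeg_content eqxx in deg_m.
(* If [f] is [f0] rearranged by [w0], right translation by [w0] carries the stabilizer of [f] to the
   permutations rearranging [f0] into [f]. Summed over [f], each permutation is then counted
   once. *)
transitivity (\sum_(f : {ffun 'I_n -> 'I_N} | content f == m)
   \sum_(w : 'S_n) ([ffun i => f0 (w i)] == f))%N.
  apply: eq_bigr => f /eqP; rewrite -f0m => /content_eq[w0 f_w0].
  rewrite [RHS](reindex_inj (mulIg w0)) /=; apply: eq_bigr => w _.
  congr (nat_of_bool _); apply/forallP/eqP => [fw|/ffunP fw i].
    apply/ffunP=> i; rewrite ffunE permM -(eqP (fw i)).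
    by rewrite [in RHS]f_w0 ffunE.
  by have := fw i; rewrite ffunE permM => <-; rewrite {1}f_w0 ffunE.
rewrite exchange_big /= muln1 -card_Sn -sum1_card.
rewrite [RHS]big_mkcond /=; apply: eq_bigr => w _.
rewrite (bigD1 [ffun i => f0 (w i)]) /= ?content_perm ?f0m //= eqxx.
rewrite big1 ?addn0 ?inE // => f /andP[_].
by rewrite eq_sym => /negPf->.
Qed.

Lemma mcoeff_complete_sym d (m : 'X_{1..N}) :
  (complete_sym C d N)@_m = (mdeg m == d)%:R.
Proof.
have -> : complete_sym C d N =
    \sum_(k : 'X_{1..N < d.+1}) (mdeg k == d)%:R *: 'X_[k].
  rewrite /complete_sym big_mkcond; apply: eq_bigr => k _.
  by case: eqP; rewrite ?scale1r ?scale0r.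
have [lt_md|le_dm] := ltnP (mdeg m) d.+1.
  by rewrite (mcoeff_mpoly (fun k => (mdeg k == d)%:R)).
rewrite gtn_eqF // raddf_sum big1 //= => k _; rewrite mcoeffZ mcoeffX.
case: (bmnm k =P m) => [km|_]; last by rewrite mulr0.
by have := leq_trans (bmdeg k) le_dm; rewrite km ltnn.
Qed.

(** The coefficient at [m] on the left counts pairs of a word of content [m] and a permutation
    fixing it, which orbit counting evaluates. *)
Lemma sum_cycle_monomial n :
  \sum_(w : 'S_n) cycle_monomial w = n`!%:R *: complete_sym C n N.
Proof.
under eq_bigr do rewrite cycle_monomialE.
apply/mpolyP=> m; rewrite mcoeffZ mcoeff_complete_sym -natrM.
rewrite -sum_card_content_stab natr_sum raddf_sum /=.
transitivity (\sum_(w : 'S_n) \sum_(f : {ffun 'I_n -> 'I_N})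
   ((content f == m) * [forall i, f (w i) == f i])%:R : C).
  apply: eq_bigr => w _; rewrite raddf_sum [LHS]big_mkcond /=.
  apply: eq_bigr => f _; rewrite mprodXE -/(content f) mcoeffX mulnC.
  by case: [forall i, _]; rewrite ?mul1n.
rewrite exchange_big [RHS]big_mkcond /=; apply: eq_bigr => f _.
rewrite -natr_sum -big_distrr /=.
by case: (content f == m); rewrite ?mul1n.
Qed.

Lemma complete_sym0 : complete_sym C 0 N = 1.
Proof.
apply/mpolyP=> m; rewrite mcoeff_complete_sym mcoeff1 mdeg_eq0.
by [].
Qed.

Lemma complete_sym1 : complete_sym C 1 N = power_sum C 1 N.
Proof.
apply/mpolyP=> m; rewrite mcoeff_complete_sym /power_sum raddf_sum /=.
under eq_bigr do rewrite expr1 mcoeffX.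
have [[i /eqP->]|nU] := mdeg1P m.
  rewrite (bigD1 i) //= eqxx big1 ?addr0 // => j ji.
  case: eqP => // /(congr1 (fun k : 'X_{1..N} => k i)).
  by rewrite !mnm1E eqxx (negPf ji).
rewrite big1 // => i _; case: eqP => // Um; case: nU; exists i.
by rewrite Um.
Qed.

(* By induction on r: nfix w ^_ r.+1 is the sum of (nfix w).-1 ^_ r over the fixed
   points of w, and deleting a fixed point leaves a permutation of n points. *)
Lemma sum_ffact_cycle_monomial n r : (r <= n)%N ->
  \sum_(w : 'S_n) (nfix w ^_ r)%:R *: cycle_monomial w
    = n`!%:R *: (complete_sym C (n - r) N * complete_sym C 1 N ^+ r).
Proof.
elim: r n => [|r IH] [|n] // le_rn.
- under eq_bigr do rewrite ffactn0 scale1r.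
  by rewrite sum_cycle_monomial expr0 mulr1.
- under eq_bigr do rewrite ffactn0 scale1r.
  by rewrite sum_cycle_monomial expr0 mulr1.
transitivity (\sum_(w : 'S_n.+1) \sum_i
    if w i == i then ((nfix w).-1 ^_ r)%:R *: cycle_monomial w else 0).
  apply: eq_bigr => w _; rewrite -big_mkcond sumr_const ffactnS natrM -scalerA.
  by rewrite scaler_nat /nfix cardsE.
rewrite exchange_big /=.
under eq_bigr => i _.
  rewrite -big_mkcond big_lift_perm /=.
  under eq_bigr do rewrite nfix_lift_perm /= cycle_monomial_lift scalerAr.
  rewrite -big_distrr /= IH // -complete_sym1.
  over.
rewrite sumr_const card_ord -scaler_nat factS natrM -scalerA.
by rewrite -scalerAr subSS exprS (mulrCA (complete_sym C 1 N)).
Qed.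

End CycleIndex.

(** * Expansion in falling factorials *)

(* For k > 0, the coefficient of x ^_ r in (x - 1) ^ k + (-1) ^ k * (x - 1); the
   recurrence comes from (x - 1) * x ^_ r = x ^_ r.+1 + (r - 1) * x ^_ r. *)
Fixpoint falling_coef (k r : nat) : nat :=
  match k, r with
  | k'.+1, 2 => odd k'
  | k'.+1, (r'.+1 as r0).+1 => falling_coef k' r0 + r0 * falling_coef k' r
  | _, _ => 0
  end.

Lemma falling_coef1 r : falling_coef 1 r = 0%N.
Proof. by case: r => [|[|[|r]]] //=; rewrite muln0. Qed.

Lemma falling_coef_lt2 k r : (r < 2)%N -> falling_coef k r = 0%N.
Proof. by case: k r => [|k] [|[|r]]. Qed.

Lemma falling_coefP (R : comNzRingType) n x k : (x <= n)%N ->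
  (x%:R - 1) ^+ k.+1 + (-1) ^+ k.+1 * (x%:R - 1)
    = \sum_(r < n.+1) (falling_coef k.+1 r * x ^_ r)%:R :> R.
Proof.
move=> le_xn; elim: k => [|k IH].
  rewrite big1 => [|r _]; last by rewrite falling_coef1.
  by rewrite !expr1 mulN1r subrr.
have x2 : x%:R * (x%:R - 1) = (x ^_ 2)%:R :> R.
  case: x {le_xn IH} => [|x]; first by rewrite mul0r.
  by rewrite ffactnS ffactn1 natrM /= -[in X in _ - X](mulr1n 1) -natrB // subn1.
have mulX r : (x%:R - 1) * (x ^_ r)%:R
    = (x ^_ r.+1)%:R + (r%:R - 1) * (x ^_ r)%:R :> R.
  have [le_rx|lt_xr] := leqP r x; last first.
    by rewrite !ffact_small ?(leqW lt_xr) // !mulr0 addr0.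
  by rewrite ffactnSr natrM natrB //; ring.
(* Multiplying the previous case by [x - 1] leaves the error
   [(-1) ^+ k.+2 * ((x - 1) + (x - 1) ^+ 2)], and the bracket is [x * (x - 1)], that is [x ^_ 2]. *)
transitivity ((x%:R - 1) * ((x%:R - 1) ^+ k.+1 + (-1) ^+ k.+1 * (x%:R - 1))
    + (-1) ^+ k.+2 * (x ^_ 2)%:R :> R).
  by rewrite -x2 !exprS; ring.
have -> : (-1) ^+ k.+2 * (x ^_ 2)%:R
    = \sum_(r < n) (if r == 1%N :> nat then (-1) ^+ k.+2 else 0) * (x ^_ r.+1)%:R
    :> R.
  have [lt1n|le_n1] := ltnP 1 n; last first.
    rewrite ffact_small ?ltnS ?(leq_trans le_xn) // mulr0 big1 // => r _.
    by rewrite ltn_eqF ?mul0r // (leq_trans (ltn_ord r)).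
  rewrite (bigD1 (Ordinal lt1n)) //= big1 ?addr0 // => r.
  by rewrite -val_eqE /= => /negPf->; rewrite mul0r.
rewrite IH mulr_sumr.
transitivity (\sum_(r < n.+1) (falling_coef k.+1 r)%:R * (x ^_ r.+1)%:R +
    \sum_(r < n.+1) (r%:R - 1) * (falling_coef k.+1 r * x ^_ r)%:R +
    \sum_(r < n) (if r == 1%N :> nat then (-1) ^+ k.+2 else 0) *
       (x ^_ r.+1)%:R :> R).
  congr (_ + _); rewrite -big_split; apply: eq_bigr => r _ /=.
  by rewrite natrM mulrCA mulX; ring.
(* The shifted sum ends with [x ^_ n.+1], which vanishes since [x <= n]. *)
rewrite [X in X + _ + _]big_ord_recr [X in _ + X + _]big_ord_recl.
rewrite [RHS]big_ord_recl /= ffact_small ?ltnS // mulr0 addr0 !mul0n mulr0.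
rewrite !add0r -!big_split; apply: eq_bigr => r _.
rewrite /bump leq0n add1n; case: (nat_of_ord r) => [|[|?]] /=.
- by rewrite !mul0n; ring.
(* At [x ^_ 2] the recurrence keeps the previous parity bit, and the added sign flips it between 0
   and 1; hence the coefficient stays nonnegative. *)
- case: k {IH} => [|k] /=; first by rewrite /= !mul0n; ring.
  rewrite -[(-1) ^+ _]signr_odd /= !negbK.
  by case: (odd k); rewrite /= ?expr1 ?expr0 ?mul0n ?mul1n; ring.
by rewrite -[in X in X - 1]natr1 addrK !natrM natrD natrM; ring.
Qed.

(** * Character and Frobenius characteristic of a virtual sum *)

Section VirtualSum.

Variables (C : numClosedFieldType) (n : nat).

Lemma mxtrace_tensor_power (U : Sn_module C n) k g :
  \tr (tensor_power U k g) = \tr (U g) ^+ k.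
Proof.
case: k => [|k]; first by rewrite [LHS]mxtrace1.
rewrite /tensor_power iteropS; elim: k => [|k IH] //=.
by rewrite mxtrace_prod IH -exprS.
Qed.

(** Traces agree on the two isomorphic modules, and an integer is its positive part minus its
    negative part. *)
Lemma mxtrace_virtual_sum (V : Sn_module C n) m c W g :
    virtual_sum V m c W ->
  \tr (V g) = \sum_(1 <= k < m.+1) (c k)%:~R * \tr (W k g).
Proof.
move=> /mxtrace_rsim/(_ g (in_setT g)); rewrite mxtrace_dadd !mxtrace_dsum.
move/(canRL (addrK _)) => ->; rewrite -sumrB; apply: eq_bigr => k _.
rewrite !mxtrace_muln; case: (c k) => a /=.
  by rewrite subr0 -pmulrn mulr_natl.
by rewrite sub0r NegzE mulrNz -pmulrn mulNr mulr_natl.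
Qed.

End VirtualSum.

Section PowerSums.

Variables (C : numClosedFieldType) (n m : nat) (V : Sn_module C n).
Variable c : nat -> int.
Hypothesis V_trace : forall g : 'S_n,
  \tr (V g) = \sum_(1 <= k < m.+1) (c k)%:~R * ((nfix g)%:R - 1) ^+ k.

(** When the alternating sum of the [c k] vanishes, these are coefficients expressing the character
    of [V] through those of the modules [inj_module C n r]. *)
Definition falling_mult r : int :=
  \sum_(1 <= k < m.+1) c k * (falling_coef k r)%:Z.

(** [c 1] may be negative, but [falling_coef 1 r] is zero. *)
Lemma falling_mult_ge0 r :
  (forall k, (2 <= k <= m)%N -> 0 <= c k) -> 0 <= falling_mult r.
Proof.
move=> c_ge0; rewrite /falling_mult big_seq; apply: sumr_ge0 => k.
rewrite mem_index_iota; case: k => [|[|k]] // le_km.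
  by rewrite falling_coef1 mulr0.
by rewrite mulr_ge0 ?c_ge0.
Qed.

Hypothesis c_sum0 : \sum_(1 <= k < m.+1) (-1) ^+ k.-1 * c k = 0.

Lemma mxtrace_falling (g : 'S_n) :
  \tr (V g) =
    \sum_(2 <= r < n.+1) (falling_mult r)%:~R * (nfix g ^_ r)%:R.
Proof.
have le_gn : (nfix g <= n)%N by rewrite -{2}(card_ord n) max_card.
have c_sum0C : \sum_(1 <= k < m.+1) (c k)%:~R * (-1) ^+ k = 0 :> C.
  transitivity ((- \sum_(1 <= k < m.+1) (-1) ^+ k.-1 * c k)%:~R : C).
    rewrite -sumrN rmorph_sum /= big_nat [RHS]big_nat.
    apply: eq_bigr => -[|k] //= _.
    by rewrite rmorphN rmorphM rmorphXn /= rmorphN1 exprS; ring.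
  by rewrite c_sum0 oppr0.
transitivity (\sum_(r < n.+1) (falling_mult r)%:~R * (nfix g ^_ r)%:R : C);
    last first.
  have mult0 r : (r < 2)%N -> falling_mult r = 0.
    by move=> lt_r2; apply: big1 => k _; rewrite falling_coef_lt2 ?mulr0.
  rewrite -(big_mkord xpredT (fun r => (falling_mult r)%:~R * (nfix g ^_ r)%:R)).
  rewrite big_ltn // mult0 // mul0r add0r.
  have [lt1n|le_n1] := ltnP 1 n.+1; last by rewrite !big_geq // ltnW.
  by rewrite big_ltn // mult0 // mul0r add0r.
(* Adding this zero replaces each [(x - 1) ^+ k] by [(x - 1) ^+ k + (-1) ^+ k * (x - 1)] at
   [x = nfix g], as [falling_coefP] requires. *)
have := mul0r ((nfix g)%:R - 1 : C); rewrite -{1}c_sum0C => sum0.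
rewrite V_trace -[LHS]addr0 -[X in _ + X]sum0.
rewrite mulr_suml -big_split /=.
under [RHS]eq_bigr do rewrite rmorph_sum mulr_suml.
rewrite exchange_big /= big_nat [RHS]big_nat; apply: eq_bigr => -[|k] //= _.
rewrite -mulrA -mulrDr (falling_coefP _ _ le_gn) mulr_sumr; apply: eq_bigr => r _.
by rewrite natrM mulrA intrM.
Qed.

(** By linearity from [mxtrace_falling]: [sum_ffact_cycle_monomial] evaluates each falling
    factorial, and its factor [n!] cancels the normalization. *)
Lemma frobenius_char_falling N :
  frobenius_char V N =
    \sum_(2 <= r < n.+1) (falling_mult r)%:~R *: h_ C (part_ones n r) N.
Proof.
have fact_neq0 : n`!%:R != 0 :> C by rewrite pnatr_eq0 -lt0n fact_gt0.
rewrite /frobenius_char.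
transitivity ((n`!%:R)^-1 *: \sum_(2 <= r < n.+1) (falling_mult r)%:~R *:
    \sum_(w : 'S_n) (nfix w ^_ r)%:R *: cycle_monomial C N w).
  congr (_ *: _); under [RHS]eq_bigr do rewrite scaler_sumr.
  rewrite exchange_big /=; apply: eq_bigr => w _.
  by rewrite mxtrace_falling scaler_suml; under [RHS]eq_bigr do rewrite scalerA.
rewrite scaler_sumr big_nat [RHS]big_nat; apply: eq_bigr => r /andP[_ le_rn].
rewrite sum_ffact_cycle_monomial // !scalerA mulrCA mulVf // mulr1.
rewrite /h_ /part_ones big_cons; congr (_ *: (_ * _)).
by rewrite big_nseq iter_mulr_1.
Qed.

End PowerSums.

(** [part_ones n n] starts with a 0 and so is not a partition; as [h_0 = 1], the partition [(1^n)]
    can stand in for it in [h_positive]. *)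
Lemma h_nseq1 (C : numClosedFieldType) n N :
  h_ C (nseq n 1%N) N = h_ C (part_ones n n) N.
Proof. by rewrite /h_ /part_ones subnn big_cons complete_sym0 mul1r. Qed.

Lemma is_partition_part_ones n r : (r < n)%N -> is_partition (part_ones n r).
Proof.
move=> lt_rn; rewrite /is_partition /part_ones inE mem_nseq andbF orbF.
rewrite eq_sym subn_eq0 -ltnNge lt_rn andbT; case: r lt_rn => //= r lt_rn.
by rewrite subn_gt0 lt_rn /=; elim: r {lt_rn} => //= r ->.
Qed.

Lemma is_partition_nseq1 n : is_partition (nseq n 1%N).
Proof.
rewrite /is_partition mem_nseq andbF andbT; case: n => //= n.
by elim: n => //= n ->.
Qed.

Theorem lemma41 (C : numClosedFieldType) (n : nat) (hn : (2 <= n)%N)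
    (V : Sn_module C n) (m : nat) (c : nat -> int)
    (hV : virtual_sum V m c (tensor_power (specht C n [:: n.-1; 1%N]))) :
  [/\ (forall g : 'S_n, (forall i, g i != i) ->
         \tr (V g) = (\sum_(1 <= k < m.+1) (-1) ^+ k * c k)%:~R),
      (\sum_(1 <= k < m.+1) (-1) ^+ k.-1 * c k = 0 ->
       h_supported_on
         (fun lam => exists2 r, (2 <= r <= n)%N & lam = part_ones n r)
         (frobenius_char V))
    & (\sum_(1 <= k < m.+1) (-1) ^+ k.-1 * c k = 0 ->
       (forall k, (2 <= k <= m)%N -> 0 <= c k) ->
       h_positive (frobenius_char V) /\ is_permutation_module V)].
Proof.
have V_trace (g : 'S_n) :
    \tr (V g) = \sum_(1 <= k < m.+1) (c k)%:~R * ((nfix g)%:R - 1) ^+ k.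
  rewrite (mxtrace_virtual_sum g hV); apply: eq_bigr => k _.
  case: n hn V g {hV} => [|[|k']] // _ V g.
  by rewrite mxtrace_tensor_power mxtrace_specht_hook.
have frob := frobenius_char_falling V_trace.
split=> [g g_free | c0 | c0 c_ge0].
- rewrite V_trace rmorph_sum; apply: eq_bigr => k _.
  have -> : nfix g = 0%N.
    apply/eqP; rewrite cards_eq0; apply/eqP/setP=> i.
    by rewrite !inE (negPf (g_free i)).
  by rewrite sub0r rmorphM rmorphXn /= rmorphN1 mulrC.
- exists [seq ((falling_mult m c r)%:~R, part_ones n r) | r <- index_iota 2 n.+1].
    by move=> t /mapP[r]; rewrite mem_index_iota => r_in ->; exists r.
  by move=> N; rewrite frob // /h_combination big_map.
have mult_ge0 r : 0 <= falling_mult m c r by apply: falling_mult_ge0.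
split.
  pose lam r := if (r < n)%N then part_ones n r else nseq n 1%N.
  exists [seq ((falling_mult m c r)%:~R, lam r) | r <- index_iota 2 n.+1].
    move=> t /mapP[r _ ->]; rewrite ler0z /lam; split=> //=.
    by case: ifP => [/is_partition_part_ones|_] //; apply: is_partition_nseq1.
  move=> N; rewrite frob // /h_combination big_map.
  apply: eq_big_nat => r /andP[_ le_rn] /=.
  congr (_ *: _); rewrite /lam; case: ltnP => // le_nr; rewrite h_nseq1.
  by congr (h_ C (part_ones n _) N); apply/eqP; rewrite eqn_leq le_nr andbT.
(* The multiplicities are nonnegative, so the expansion of the character of [V] is that of this
   genuine permutation module. *)
pose P : Sn_module C n := \big[dadd_grepr/grepr0]_(2 <= r < n.+1)
  muln_grepr (inj_module C n r) `|falling_mult m c r|%N.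
apply: (@permutation_module_rsim _ _ _ P).
  apply: mxtrace_eq_rsim => [|g _]; first exact: pchar_num.
  rewrite (mxtrace_falling V_trace) // mxtrace_dsum; apply: eq_bigr => r _.
  rewrite mxtrace_muln mxtrace_inj_module -{1}(gez0_abs (mult_ge0 r)).
  by rewrite -pmulrn mulr_natl.
apply: permutes_basis_dsum => r; apply: permutes_basis_dsum => _.
exact: permutes_basis_inj.
Qed.
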